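(* For a finite simple graph $G$ the following statements are equivalent: (1) $G$ is a bipartite elementary graph. (2) $G$ has edge-chromatic index at most $2$. (3) $G$ admits a $\{{}^rP_3,{}^bP_3,{}^rK_3,{}^bK_3,{}^{rrb}K_3,{}^{rbb}K_3\}$-free $2$-edge-colouring.
   Context: Graphs are finite and simple. A $2$-edge-colouring of $G$ assigns to every edge the colour red or blue (not necessarily properly). For a set $\mathcal F$ of $2$-edge-coloured graphs, a $2$-edge-colouring of $G$ is $\mathcal F$-free if no induced $2$-edge-coloured subgraph is isomorphic (preserving colours) to a member of $\mathcal F$. Patterns on three vertices: ${}^rP_3$ (resp. ${}^bP_3$) is the path on three vertices with both edges red (resp. blue); ${}^rK_3$ (resp. ${}^bK_3$) is the triangle with all edges red (resp. blue); ${}^{rrb}K_3$ is the triangle with two red and one blue edge; ${}^{rbb}K_3$ is the triangle with one red and two blue edges. A graph is elementary if it admits a $\{{}^rP_3,{}^bP_3\}$-free $2$-edge-colouring. The edge-chromatic index is the least number of colours in a proper edge-colouring. *)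

(* Defs.v *)
From Stdlib Require List.
From mathcomp Require Import all_boot.

Set Implicit Arguments.
Unset Strict Implicit.
Unset Printing Implicit Defensive.

Record sgraph := SGraph {
  vertex :> finType;
  adj : rel vertex;
  adj_sym : symmetric adj;
  adj_irrefl : irreflexive adj }.

Definition edges (G : sgraph) : {set {set G}} :=
  [set [set p.1; p.2] | p : G * G & adj p.1 p.2].

(* Edge-colourings are functions on this type, so that an edgeless graph does
   have an edge-colouring with no colours. *)
Definition edge (G : sgraph) : finType := {A : {set G} | A \in edges G}.

Definition bipartite (G : sgraph) : Prop :=
  exists A : {set G}, forall x y : G, adj x y -> (x \in A) != (y \in A).

Definition proper (G : sgraph) (K : eqType) (c : edge G -> K) : bool :=
  [forall e1 : edge G, forall e2 : edge G,
     (e1 != e2) && (val e1 :&: val e2 != set0) ==> (c e1 != c e2)].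

Definition edge_colourable (G : sgraph) (k : nat) : bool :=
  [exists c : {ffun edge G -> 'I_k}, proper c].

Lemma edge_colourable_exists (G : sgraph) : exists k, edge_colourable G k.
Proof.
exists #|edge G|; apply/existsP; exists [ffun e => enum_rank e].
apply/forallP=> e1; apply/forallP=> e2; apply/implyP=> /andP[ne _].
by rewrite !ffunE (inj_eq enum_rank_inj).
Qed.

Definition edge_chromatic_index (G : sgraph) : nat :=
  ex_minn (edge_colourable_exists G).

Variant colour := Red | Blue.

Record ecgraph := ECGraph {
  ugraph :> sgraph;
  ecol : edge ugraph -> colour }.

Section Induced.

Variables (G : sgraph) (S : {set G}).

Definition induced_adj : rel {x : G | x \in S} :=
  fun x y => adj (val x) (val y).

Fact induced_adj_sym : symmetric induced_adj.
Proof. by move=> x y; apply: adj_sym. Qed.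

Fact induced_adj_irrefl : irreflexive induced_adj.
Proof. by move=> x; apply: adj_irrefl. Qed.

Definition induced : sgraph := SGraph induced_adj_sym induced_adj_irrefl.

Fact induced_edge_subproof (e : edge induced) :
  [set val x | x in val e] \in edges G.
Proof.
case: e => A /= /imsetP[[x y] /=]; rewrite inE /= => xy ->.
by rewrite imsetU1 imset_set1; apply/imsetP; exists (val x, val y); rewrite ?inE.
Qed.

Definition induced_edge (e : edge induced) : edge G :=
  exist (fun A => A \in edges G) _ (induced_edge_subproof e).

End Induced.

Definition ec_induced (H : ecgraph) (S : {set H}) : ecgraph :=
  @ECGraph (induced S) (fun e => ecol (induced_edge e)).

Definition ec_iso (H1 H2 : ecgraph) : Prop :=
  exists f : H1 -> H2,
    [/\ bijective f,
        forall x y : H1, adj (f x) (f y) = adj x y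
      & forall (e1 : edge H1) (e2 : edge H2),
          val e2 = [set f x | x in val e1] -> ecol e2 = ecol e1].

Definition free_colouring (F : ecgraph -> Prop) (G : sgraph)
    (c : edge G -> colour) : Prop :=
  forall (P : ecgraph) (S : {set G}),
    F P -> ~ ec_iso (@ec_induced (ECGraph c) S) P.

Definition patterns (s : seq ecgraph) : ecgraph -> Prop :=
  fun P => List.In P s.

Definition P3_adj : rel 'I_3 :=
  fun i j => (i.+1 == j :> nat) || (j.+1 == i :> nat).

Fact P3_adj_sym : symmetric P3_adj.
Proof. by move=> i j; apply: orbC. Qed.

Fact P3_adj_irrefl : irreflexive P3_adj.
Proof. by move=> i; rewrite /P3_adj orbb gtn_eqF. Qed.

Definition P3 : sgraph := SGraph P3_adj_sym P3_adj_irrefl.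

Definition K3_adj : rel 'I_3 := fun i j => i != j.

Fact K3_adj_sym : symmetric K3_adj.
Proof. by move=> i j; rewrite /K3_adj eq_sym. Qed.

Fact K3_adj_irrefl : irreflexive K3_adj.
Proof. by move=> i; rewrite /K3_adj eqxx. Qed.

Definition K3 : sgraph := SGraph K3_adj_sym K3_adj_irrefl.

Definition K3_edge01 (e : edge K3) : bool :=
  val e == [set inord 0; inord 1] :> {set 'I_3}.

Definition rP3 : ecgraph := @ECGraph P3 (fun=> Red).
Definition bP3 : ecgraph := @ECGraph P3 (fun=> Blue).
Definition rK3 : ecgraph := @ECGraph K3 (fun=> Red).
Definition bK3 : ecgraph := @ECGraph K3 (fun=> Blue).
Definition rrbK3 : ecgraph :=
  @ECGraph K3 (fun e => if K3_edge01 e then Blue else Red).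
Definition rbbK3 : ecgraph :=
  @ECGraph K3 (fun e => if K3_edge01 e then Red else Blue).

Definition elementary (G : sgraph) : Prop :=
  exists c : edge G -> colour, free_colouring (patterns [:: rP3; bP3]) c.

(* Main.v *)
Require Import Defs.
From mathcomp Require Import all_boot.
From mathcomp Require Import zify.

(** A [2]-edge-colouring is proper exactly when no two edges [xy], [xz] of the
    same colour meet; such a pair spans a monochromatic induced path or one of
    the four coloured triangles, and a bipartite graph has no triangle.
    Conversely the two colour classes of a proper colouring are matchings.  On
    two copies of the graph, with the two copies of each unmatched vertex
    joined, they become fixed-point-free involutions [a] and [b]; then [x] and
    [a x] lie in distinct orbits of [a \o b], and [a] and [b] induce the same
    pairing of these orbits, so choosing one orbit in each pair gives a
    bipartition. *)

Set Implicit Arguments.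
Unset Strict Implicit.
Unset Printing Implicit Defensive.

(** * Edges as two-element sets *)

Lemma set2_inj (T : finType) (x y u v : T) :
  [set x; y] = [set u; v] -> (x = u /\ y = v) \/ (x = v /\ y = u).
Proof.
move=> /setP eqs.
have := (eqs x, eqs y, eqs u, eqs v); rewrite !inE !eqxx ?orbT.
case=> [[[]]] /esym/orP[]/eqP-> /esym/orP[]/eqP->; rewrite ?eqxx ?orbb ?orbT.
- by move=> _ /eqP->; left.
- by left.
- by right.
- by move=> /eqP-> _; left.
Qed.

Lemma mem_edges (G : sgraph) (x y : G) : ([set x; y] \in edges G) = adj x y.
Proof.
apply/imsetP/idP => [[[u v]]|xy]; last by exists (x, y); rewrite ?inE.
rewrite inE /= => uv /set2_inj[] [-> ->] //.
by rewrite adj_sym.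
Qed.

Lemma edgeP (G : sgraph) (e : edge G) (x : G) :
  x \in val e -> exists y, val e = [set x; y].
Proof.
case: e => A /= /imsetP[[u v] _ ->] /=.
by rewrite !inE => /orP[]/eqP->; [exists v | exists u; rewrite setUC].
Qed.

Lemma edge_nonempty (G : sgraph) (e : edge G) : exists x, x \in val e.
Proof.
by case: e => A /= /imsetP[[u v] _ ->] /=; exists u; rewrite !inE eqxx.
Qed.

(** * Coloured graphs described by the colours of pairs of vertices *)

(** [None] marks non-adjacency, so this single function records both the graph and its colouring. *)
Definition pair_col (H : ecgraph) (x y : H) : option colour :=
  omap (@ecol H) (insub [set x; y]).

Section PairColour.

Variable H : ecgraph.
Implicit Types x y : H.

Lemma pair_colC x y : pair_col x y = pair_col y x.
Proof. by rewrite /pair_col setUC. Qed.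

Lemma pair_colN x y : ~~ adj x y -> pair_col x y = None.
Proof. by move=> xy; rewrite /pair_col insubN // mem_edges. Qed.

Lemma pair_col_edge x y (e : edge H) :
  val e = [set x; y] -> pair_col x y = Some (ecol e).
Proof. by rewrite /pair_col => <-; rewrite valK. Qed.

Lemma pair_col_ex x y k : pair_col x y = Some k ->
  exists2 e : edge H, val e = [set x; y] & ecol e = k.
Proof. by rewrite /pair_col; case: insubP => //= e _ <- [<-]; exists e. Qed.

Lemma adjE x y : adj x y = isSome (pair_col x y).
Proof. by rewrite -mem_edges /pair_col; case: insubP => [e -> //|/negPf]. Qed.

Lemma pair_colxx x : pair_col x x = None.
Proof. by rewrite pair_colN // adj_irrefl. Qed.

End PairColour.

Lemma ec_isoP (H1 H2 : ecgraph) :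
  ec_iso H1 H2 <-> exists2 f : H1 -> H2, bijective f &
    forall x y, pair_col (f x) (f y) = pair_col x y.
Proof.
split=> [[f [bij_f adj_f col_f]]|[f bij_f col_f]]; exists f => //.
  move=> x y; case Dk: (pair_col x y) => [k|]; last first.
    by rewrite pair_colN // adj_f adjE Dk.
  have [e De <-] := pair_col_ex Dk.
  have: adj (f x) (f y) by rewrite adj_f adjE Dk.
  rewrite adjE; case Dk': pair_col => [k'|//] _.
  have [e' De' <-] := pair_col_ex Dk'; congr Some; apply: col_f.
  by rewrite De De' imsetU1 imset_set1.
split=> // [x y|e1 e2]; first by rewrite !adjE col_f.
have [x /edgeP[y De1]] := edge_nonempty e1.
rewrite De1 imsetU1 imset_set1 => De2.
by have := col_f x y; rewrite (pair_col_edge De1) (pair_col_edge De2) => -[].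
Qed.

Lemma pair_col_induced (H : ecgraph) (S : {set H}) (x y : ec_induced S) :
  pair_col x y = pair_col (val x) (val y).
Proof.
case Dk: (pair_col x y) => [k|].
  have [e De <-] := pair_col_ex Dk.
  apply/esym/(@pair_col_edge H _ _ (induced_edge e)).
  by rewrite /= De imsetU1 imset_set1.
apply/esym/pair_colN; have := adjE x y.
by rewrite Dk /= /induced_adj => ->.
Qed.

(** A pattern occurs on [S] exactly when it embeds with image [S]; agreement of [pair_col] preserves
    non-edges too, which makes the copy induced. *)
Lemma free_colouringP (F : ecgraph -> Prop) (G : sgraph)
    (c : edge G -> colour) :
  free_colouring F c <->
  forall (P : ecgraph) (f : P -> ECGraph c), F P -> injective f ->
    ~ forall x y, pair_col (f x) (f y) = pair_col x y.
Proof.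
split=> [free P f FP inj_f col_f|free P S FP].
  pose S := [set f x | x in P].
  have fS x : f x \in S by apply: imset_f.
  pose h x : {x | x \in S} := exist _ (f x) (fS x).
  have inj_h : injective h by move=> x y /(congr1 val) /inj_f.
  have [|g hK gK] := inj_card_bij inj_h.
    by rewrite card_sig (card_imset _ inj_f) leqnn.
  apply: (free P S FP); apply/ec_isoP; exists g; first by exists h.
  by move=> x y; rewrite -col_f pair_col_induced -[in RHS](gK x) -[in RHS](gK y).
move=> /ec_isoP[f [g fK gK] col_f].
apply: (free P (fun x => val (g x)) FP) => [x y /val_inj|x y].
  exact: (can_inj gK).
by rewrite -(gK x) -(gK y) col_f pair_col_induced !gK.
Qed.

(** * Proper colourings with two colours and the chromatic index *)

(** Stated at a common vertex [x] instead of on meeting edges as in [proper], the form in which it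
    meets both the patterns and the matchings. *)
Definition properly_coloured (H : ecgraph) : Prop :=
  forall (x y z : H) k,
    pair_col x y = Some k -> pair_col x z = Some k -> y = z.

Lemma edge_chromatic_index_le2 (G : sgraph) :
  edge_chromatic_index G <= 2 <->
  exists c : edge G -> colour, properly_coloured (ECGraph c).
Proof.
rewrite /edge_chromatic_index; case: ex_minnP => n col_n min_n.
split=> [le_n2|[c proper_c]].
  have /existsP[c /forallP proper_c] := col_n.
  (* The index [n] may be less than 2; since [n <= 2], a nonzero colour can only be 1, so no two
     colours are merged. *)
  exists (fun e => if c e == 0 :> nat then Red else Blue).
  move=> x y z k /pair_col_ex[/= e1 De1 <-] /pair_col_ex[/= e2 De2].
  have [e12 _|ne12] := eqVneq e1 e2.
    by move: De2; rewrite -e12 De1 => /set2_inj[] [] // -> ->.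
  have /forallP/(_ e2) := proper_c e1; rewrite ne12 /=.
  have -> /= : sval e1 :&: sval e2 != set0.
    by apply/set0Pn; exists x; rewrite De1 De2 !inE eqxx.
  have := ltn_ord (c e1); have := ltn_ord (c e2); rewrite -val_eqE /=.
  by do 3!case: eqP => //; lia.
apply: min_n; apply/existsP.
exists [ffun e => if c e is Red then ord0 else ord_max].
apply/forallP=> e1; apply/forallP=> e2; apply/implyP=> /andP[ne12].
case/set0Pn=> x; rewrite inE => /andP[/edgeP[y De1] /edgeP[z De2]].
have neq_c : c e1 <> c e2.
  move=> eq_c; case/eqP: ne12; apply: val_inj; rewrite De1 De2.
  have := @proper_c x y z (c e1).
  rewrite (@pair_col_edge (ECGraph c) _ _ e1) //.
  by rewrite (@pair_col_edge (ECGraph c) _ _ e2) //= eq_c => ->.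
by rewrite !ffunE; case: (c e1) (c e2) neq_c => [] [].
Qed.

(** * Bipartition of a union of two matchings *)

Lemma involutions_bipartition (T : finType) (a b : T -> T) :
    involutive a -> involutive b ->
    (forall x, a x != x) -> (forall x, b x != x) ->
  exists A : {set T},
    forall x, (a x \in A) = (x \notin A) /\ (b x \in A) = (x \notin A).
Proof.
move=> aK bK a_free b_free; pose s := a \o b.
have inj_s : injective s by apply: inj_comp; apply: inv_inj.
have rootE x y : (froot s x == froot s y) = fconnect s x y.
  by apply: root_connect; apply: fconnect_sym.
have iter_neq k x : iter k s x <> a x.
  have [n le_kn] := ubnP k; elim: n => // n IHn in k x le_kn *.
  case: k le_kn => [_ /esym/eqP|[_|k le_kn]]; first exact/negP.
    by move=> /(inv_inj aK)/eqP; apply/negP.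
  (* The cases 0 and 1 would give fixed points of [a] and [b]. From [iter k.+2 s x = a x],
     cancelling [a] and then [b] yields [iter k s (s x) = b x = a (s x)], the same equation at [s x]
     with exponent lowered by 2. *)
  rewrite iterS => /(inv_inj aK)/(canRL bK); rewrite iterSr.
  rewrite -[b x]aK; apply: IHn; lia.
have root_a x : froot s x != froot s (a x).
  rewrite rootE; apply/negP=> /iter_findex; exact: iter_neq.
have root_b x : froot s (b x) = froot s (a x).
  apply/eqP; rewrite rootE.
  by have := fconnect1 s (b x); rewrite /s /= bK.
have root_ab x : froot s (a (b x)) = froot s x.
  by apply/esym/eqP; rewrite rootE; apply: fconnect1.
(* Numbering the orbits by their roots selects one orbit of each pair: the one with the smaller
   number. *)
pose rk x := enum_rank (froot s x) : nat.
have rk_a x : rk x != rk (a x).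
  by rewrite (inj_eq val_inj) (inj_eq enum_rank_inj).
exists [set x | rk x < rk (a x)] => x.
by rewrite !inE /rk aK root_b root_ab; split; move: (rk_a x); rewrite /rk; lia.
Qed.

(* The fixed-point-free involution given by the matching [r] on two copies of
   [T], in which the two copies of each unmatched vertex are exchanged. *)
Definition double_matching (T : finType) (r : rel T) (p : T * bool) :=
  if [pick y | r p.1 y] is Some y then (y, p.2) else (p.1, ~~ p.2).

Section DoubleMatching.

Variables (T : finType) (r : rel T).
Hypotheses (sym_r : symmetric r) (irr_r : irreflexive r).
Hypothesis fun_r : forall x y z, r x y -> r x z -> y = z.

Lemma double_matchingE x y i :
  r x y -> double_matching r (x, i) = (y, i).
Proof.
move=> rxy; rewrite /double_matching; case: pickP => [z /= rxz|/(_ y)] /=.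
  by rewrite (fun_r rxy rxz).
by rewrite rxy.
Qed.

Lemma double_matchingK : involutive (double_matching r).
Proof.
case=> x i; rewrite {2}/double_matching; case: pickP => [y /= rxy|/= r0].
  by apply: double_matchingE; rewrite sym_r.
by rewrite /double_matching; case: pickP => [y /=|_]; rewrite /= ?r0 ?negbK.
Qed.

Lemma double_matching_free p : double_matching r p != p.
Proof.
case: p => x i; rewrite /double_matching.
case: pickP => [y /= rxy|_] /=; rewrite xpair_eqE; last first.
  by case: i; rewrite andbF.
by rewrite eqxx andbT; apply: contraTneq rxy => ->; rewrite irr_r.
Qed.

End DoubleMatching.

(** Doubling turns the matchings into fixed-point-free involutions. Matched vertices stay in their
    own copy, so the bipartition of the double restricts to one copy. *)
Lemma matchings_bipartition (T : finType) (r1 r2 : rel T) :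
    symmetric r1 -> irreflexive r1 ->
    (forall x y z, r1 x y -> r1 x z -> y = z) ->
    symmetric r2 -> irreflexive r2 ->
    (forall x y z, r2 x y -> r2 x z -> y = z) ->
  exists A : {set T},
    forall x y, r1 x y || r2 x y -> (x \in A) != (y \in A).
Proof.
move=> sym1 irr1 fun1 sym2 irr2 fun2.
have [A bipA] := involutions_bipartition
  (double_matchingK sym1 fun1) (double_matchingK sym2 fun2)
  (double_matching_free irr1) (double_matching_free irr2).
exists [set x | (x, true) \in A] => x y; rewrite !inE.
have [] := bipA (x, true).
move=> A1 A2 /orP[rxy|rxy].
  by move: A1; rewrite (double_matchingE fun1 _ rxy) => ->; case: (_ \in A).
by move: A2; rewrite (double_matchingE fun2 _ rxy) => ->; case: (_ \in A).
Qed.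

Lemma properly_coloured_bipartite (H : ecgraph) :
  properly_coloured H -> bipartite H.
Proof.
move=> proper_H.
pose r1 (x y : H) := if pair_col x y is Some Red then true else false.
pose r2 (x y : H) := if pair_col x y is Some Blue then true else false.
have r1P x y : r1 x y -> pair_col x y = Some Red.
  by rewrite /r1; case: pair_col => [[]|].
have r2P x y : r2 x y -> pair_col x y = Some Blue.
  by rewrite /r2; case: pair_col => [[]|].
have [||x y z /r1P xy /r1P|||x y z /r2P xy /r2P|A bipA] :=
  @matchings_bipartition H r1 r2.
- by move=> x y; rewrite /r1 pair_colC.
- by move=> x; rewrite /r1 pair_colxx.
- exact: proper_H xy.
- by move=> x y; rewrite /r2 pair_colC.
- by move=> x; rewrite /r2 pair_colxx.
- exact: proper_H xy.
exists A => x y; rewrite adjE => xy; apply: bipA; move: xy; rewrite /r1 /r2.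
by case: pair_col => [[]|].
Qed.

(** * The patterns and their embeddings *)

Lemma pair_col_const (G : sgraph) k (x y : @ECGraph G (fun=> k)) :
  pair_col x y = if adj x y then Some k else None.
Proof.
by rewrite adjE; case Dk: pair_col => [k'|//]; have [e _ <-] := pair_col_ex Dk.
Qed.

(** Treats all four triangles at once: the edges at [ord_max] have colour [k] and the opposite edge
    has colour [l], with [k = l] in the monochromatic cases. *)
Lemma pair_col_K3 (c : edge K3 -> colour) k l (x y : 'I_3) :
    (forall e, c e = if K3_edge01 e then l else k) ->
  @pair_col (ECGraph c) x y =
  if x == y then None
  else Some (if (x != ord_max) && (y != ord_max) then l else k).
Proof.
move=> cE; set H := ECGraph _; have [-> | ne_xy] := eqVneq x y; first exact: pair_colxx.
have: @adj H x y by [].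
rewrite adjE; case Dk: pair_col => [k'|//] _.
have [e De <-] := pair_col_ex Dk; congr Some; rewrite /= cE /K3_edge01 De.
congr (if _ then _ else _).
rewrite eqEsubset !subUset !sub1set !inE -!val_eqE /= !inordK //.
by case: x y ne_xy {e De Dk} => [[|[|[|]]] // ?] [[|[|[|]]] // ?].
Qed.

Lemma P3_not_properly_coloured k :
  ~ properly_coloured (@ECGraph P3 (fun=> k)).
Proof.
move/(_ (@Ordinal 3 1 isT) ord0 ord_max k); rewrite !pair_col_const.
by move=> /(_ erefl erefl).
Qed.

Lemma K3_not_properly_coloured (c : edge K3 -> colour) k l :
    (forall e, c e = if K3_edge01 e then l else k) ->
  ~ properly_coloured (ECGraph c).
Proof.
move=> cE /(_ ord_max ord0 (@Ordinal 3 1 isT) k).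
by rewrite !(pair_col_K3 _ _ cE) => /(_ erefl erefl).
Qed.

Lemma properly_coloured_embedding (P H : ecgraph) (f : P -> H) :
    injective f -> (forall x y, pair_col (f x) (f y) = pair_col x y) ->
  properly_coloured H -> properly_coloured P.
Proof.
move=> inj_f col_f proper_H x y z k; rewrite -!col_f => xy xz.
exact: inj_f (proper_H _ _ _ _ xy xz).
Qed.

Section Embeddings.

Variables (H : ecgraph) (x y z : H) (k : colour).
Hypotheses (xy : pair_col x y = Some k) (xz : pair_col x z = Some k).
Hypothesis ne_yz : y != z.

Let ne_xy : x != y.
Proof. by apply/eqP=> e; move: xy; rewrite e pair_colxx. Qed.

Let ne_xz : x != z.
Proof. by apply/eqP=> e; move: xz; rewrite e pair_colxx. Qed.

Lemma P3_embedding : pair_col y z = None ->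
  exists2 f : @ECGraph P3 (fun=> k) -> H, injective f &
    forall i j, pair_col (f i) (f j) = pair_col i j.
Proof.
(* [P3] joins consecutive indices, so the common vertex [x] takes the middle place; the default of
   [nth] is never reached. *)
move=> yz; exists (fun i : 'I_3 => nth x [:: y; x; z] i).
  move=> i j /eqP; rewrite nth_uniq //= ?inE ?negb_or ?ne_yz ?ne_xz.
    by move/eqP/val_inj.
  by rewrite eq_sym ne_xy.
case=> [[|[|[|]]] // ?] [[|[|[|]]] // ?]; rewrite pair_col_const /=;
  by rewrite ?pair_colxx // 1?pair_colC // 1?pair_colC.
Qed.

Lemma K3_embedding (c : edge K3 -> colour) l : pair_col y z = Some l ->
    (forall e, c e = if K3_edge01 e then l else k) ->
  exists2 f : ECGraph c -> H, injective f &
    forall i j, pair_col (f i) (f j) = pair_col i j.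
Proof.
(* Here [x] comes last, so that [y] and [z] fall on the distinguished edge of [K3]. *)
move=> yz cE; exists (fun i : 'I_3 => nth x [:: y; z; x] i).
  move=> i j /eqP; rewrite nth_uniq //= ?inE ?negb_or ?ne_yz.
    by move/eqP/val_inj.
  by rewrite ![_ == x]eq_sym ne_xy ne_xz.
case=> [[|[|[|]]] // ?] [[|[|[|]]] // ?]; rewrite (pair_col_K3 _ _ cE) /=;
  by rewrite ?pair_colxx // 1?pair_colC // 1?pair_colC.
Qed.

End Embeddings.

Theorem proposition14 (G : sgraph) :
  [<-> bipartite G /\ elementary G;
       edge_chromatic_index G <= 2;
       exists c : edge G -> colour,
         free_colouring (patterns [:: rP3; bP3; rK3; bK3; rrbK3; rbbK3]) c].
Proof.
split=> [[[A bipA] [c /free_colouringP free_c]]|].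
  apply/edge_chromatic_index_le2; exists c => x y z k xy xz.
  apply/eqP/negPn/negP => ne_yz.
  (* Both [y] and [z] lie on the side of the bipartition opposite to [x]. *)
  have yz : @pair_col (ECGraph c) y z = None.
    apply: pair_colN; apply/negP=> /bipA.
    have /bipA : adj x y by rewrite (@adjE (ECGraph c)) xy.
    have /bipA : adj x z by rewrite (@adjE (ECGraph c)) xz.
    by do 3!case: (_ \in A).
  have [f inj_f] := P3_embedding xy xz ne_yz yz.
  by apply: free_c inj_f; case: k {xy xz f} => /=; auto.
split=> [/edge_chromatic_index_le2[c proper_c]|[c free_c]].
  exists c; apply/free_colouringP => P f FP inj_f col_f.
  have proper_P := properly_coloured_embedding inj_f col_f proper_c.
  move: proper_P; case: FP => [<-|[<-|[<-|[<-|[<-|[<-|[]]]]]]].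
  - exact: P3_not_properly_coloured.
  - exact: P3_not_properly_coloured.
  - by apply: (@K3_not_properly_coloured _ Red Red) => e; case: ifP.
  - by apply: (@K3_not_properly_coloured _ Blue Blue) => e; case: ifP.
  - exact: (@K3_not_properly_coloured _ Red Blue).
  - exact: (@K3_not_properly_coloured _ Blue Red).
(* The same colouring shows that [G] is elementary, as fewer patterns are forbidden; bipartiteness
   follows once the colouring is known to be proper. *)
split; last first.
  exists c => P S FP; apply: free_c; move: FP; rewrite /patterns /=; tauto.
apply: (@properly_coloured_bipartite (ECGraph c)) => x y z k xy xz.
move/free_colouringP in free_c; apply/eqP/negPn/negP => ne_yz.
(* If [y] and [z] are adjacent, the colours [k] and [l] select the forbidden triangle; otherwise a
   monochromatic path arises. *)
case yz: (@pair_col (ECGraph c) y z) => [l|].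
  case: k l xy xz yz => [] [] xy xz yz.
  - have [|f inj_f] := @K3_embedding _ _ _ _ _ xy xz ne_yz (@ecol rK3) _ yz.
      by move=> e; case: ifP.
    by apply: free_c inj_f; rewrite /patterns /=; auto.
  - have [|f inj_f] := @K3_embedding _ _ _ _ _ xy xz ne_yz (@ecol rrbK3) _ yz.
      by [].
    by apply: free_c inj_f; rewrite /patterns /=; auto 6.
  - have [|f inj_f] := @K3_embedding _ _ _ _ _ xy xz ne_yz (@ecol rbbK3) _ yz.
      by [].
    by apply: free_c inj_f; rewrite /patterns /=; auto 7.
  - have [|f inj_f] := @K3_embedding _ _ _ _ _ xy xz ne_yz (@ecol bK3) _ yz.
      by move=> e; case: ifP.
    by apply: free_c inj_f; rewrite /patterns /=; auto.
have [f inj_f] := P3_embedding xy xz ne_yz yz.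
by apply: free_c inj_f; case: k {xy xz f} => /=; auto.
Qed.
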